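(* Let $G$ be a finite simple graph on the ambient vertex set $[n]=\{1,\dots,n\}$, labeled so that $\deg_G(1)\ge\deg_G(2)\ge\cdots\ge\deg_G(n)$. Write $$d_r^{\mathsf T}(G)=\bigl|\{v\in[n]:\deg_G(v)\ge r\}\bigr|$$ for its conjugate degree sequence, and let $\mu_1(G)\ge\cdots\ge\mu_n(G)=0$ be its Laplacian eigenvalues. Then there is a threshold graph $H$ on $[n]$ with $|E(H)|=|E(G)|$ such that $$\tfrac12\bigl|E(G)\,\triangle\,E(H)\bigr|\ \le\ \tfrac12\left[\sum_{r\ge1}\bigl(d_r^{\mathsf T}(G)\bigr)^2-\sum_{i=1}^{n}\mu_i(G)^2\right].$$ In particular, if the second-moment gap $\sum_{r\ge1}\bigl(d_r^{\mathsf T}(G)\bigr)^2-\sum_{i=1}^{n}\mu_i(G)^2$ vanishes, then $G$ is a threshold graph.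
   Context: $E(G)$ is the edge set, regarded as a set of $2$-element subsets of $[n]$; $\triangle$ is symmetric difference. The Laplacian of $G$ is the matrix $D-A$ (degree matrix minus adjacency matrix), with eigenvalues listed with multiplicity. A threshold graph is a graph obtainable from a single vertex by successively adding an isolated vertex or a dominating vertex; equivalently, after some relabeling of its vertices by $1,\dots,n$, its edge set is shifted, i.e. closed under replacing an endpoint $j$ of an edge not containing $i$ by any smaller label $i<j$. *)

(* Defs.v *)
From mathcomp Require Import all_boot all_order all_algebra.
From mathcomp Require complex.

Set Implicit Arguments.
Unset Strict Implicit.
Unset Printing Implicit Defensive.

Import Order.TTheory GRing.Theory Num.Theory.

Local Open Scope ring_scope.

Record sgraph (T : finType) := SGraph {
  edges : {set {set T}};
  edges_card2 : forall e, e \in edges -> #|e| = 2%N }.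

Section Graphs.

Variable T : finType.
Implicit Types G H : sgraph T.

(* [set u; u] is a singleton, hence never an edge: [adj G] is irreflexive. *)
Definition adj G (u v : T) : bool := [set u; v] \in edges G.

Definition deg G (v : T) : nat := #|[set w | adj G v w]|.

Definition conj_deg G (r : nat) : nat := #|[set v | (r <= deg G v)%N]|.

(* [threshold_build V E]: the graph with vertex set V and edge set E is
   obtained from one vertex by adding isolated or dominating vertices. *)
Inductive threshold_build : {set T} -> {set {set T}} -> Prop :=
| ThresholdVertex v : threshold_build [set v] set0
| ThresholdIsolated (V : {set T}) (E : {set {set T}}) v :
    v \notin V -> threshold_build V E -> threshold_build (v |: V) E
| ThresholdDominating (V : {set T}) (E : {set {set T}}) v :
    v \notin V -> threshold_build V E ->
    threshold_build (v |: V) (E :|: [set [set v; w] | w in V]).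

Definition is_threshold G : Prop := threshold_build [set: T] (edges G).

End Graphs.

Definition symdiff (T : finType) (A B : {set T}) : {set T} :=
  (A :\: B) :|: (B :\: A).

Section Laplacian.

Variables (R : rcfType) (n : nat).
Implicit Type G : sgraph 'I_n.

Definition degree_mx G : 'M[R]_n := diag_mx (\row_i (deg G i)%:R).

Definition adjacency_mx G : 'M[R]_n := \matrix_(i, j) (adj G i j)%:R.

Definition laplacian G : 'M[R]_n := degree_mx G - adjacency_mx G.

(* mu lists the eigenvalues of A in nonincreasing order, each one repeated
   according to its multiplicity. *)
Definition is_spectrum (A : 'M[R]_n) (mu : 'I_n -> R) : Prop :=
  char_poly A = \prod_(i < n) ('X - (mu i)%:P) /\
  (forall i j : 'I_n, (i <= j)%N -> mu j <= mu i).

(* Degrees on n vertices are less than n, so the terms r > n of the sum over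
   all r >= 1 vanish. *)
Definition second_moment_gap G (mu : 'I_n -> R) : R :=
  \sum_(1 <= r < n.+1) (conj_deg G r)%:R ^+ 2 - \sum_(i < n) mu i ^+ 2.

End Laplacian.

Section SpectrumExists.

Import complex.

Lemma char_poly_conj (F : fieldType) n (P A : 'M[F]_n) :
  P \in unitmx -> char_poly (invmx P *m A *m P) = char_poly A.
Proof.
move=> uP; rewrite /char_poly.
have -> : char_poly_mx (invmx P *m A *m P) =
    map_mx polyC (invmx P) *m char_poly_mx A *m map_mx polyC P.
  rewrite /char_poly_mx mulmxBr mulmxBl -!map_mxM; congr (_ - _).
  by rewrite mul_mx_scalar -scalemxAl -map_mxM mulVmx // map_mx1 scalemx1.
rewrite !det_mulmx mulrAC -det_mulmx -map_mxM mulVmx // map_mx1 det1.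
by rewrite mul1r.
Qed.

Lemma sym_spectrum_exists (R : rcfType) n (A : 'M[R]_n) :
  A^T = A -> exists mu, is_spectrum A mu.
Proof.
move=> symA; pose f := real_complex R; pose B := map_mx f A.
have hermB : B \is hermsymmx.
  apply: realsym_hermsym.
    apply/is_hermitianmxP; rewrite expr0 scale1r map_mx_id // map_trmx symA //.
  by apply/mxOverP=> i j; rewrite mxE complex_real.
have realB := hermitian_spectral_diag_real hermB.
pose s := [seq Re (spectral_diag B 0 i) | i <- enum 'I_n].
have cpA : char_poly A = \prod_(x <- s) ('X - x%:P).
  apply: (@map_poly_inj _ _ f); rewrite map_char_poly -/B.
  have /hermitian_normalmx/orthomx_spectralP {1}-> := hermB.
  rewrite char_poly_conj ?spectral_unit // char_poly_trig ?diag_mx_is_trig //.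
  rewrite rmorph_prod /= big_map big_enum /=; apply: eq_bigr => i _.
  rewrite rmorphB /= map_polyX map_polyC /= mxE eqxx mulr1n.
  by rewrite /f RRe_real //; move/mxOverP: realB; apply.
pose t := sort (fun x y => y <= x) s.
have st : size t = n by rewrite size_sort size_map size_enum_ord.
have tot : total (fun x y : R => y <= x) by move=> x y; apply: le_total.
exists (fun i => t`_i); split=> [|i j ij].
  rewrite cpA -(perm_big _ (permEl (perm_sort (fun x y => y <= x) s))) /=.
  by rewrite (big_nth 0) -/t st big_mkord.
have tr : transitive (fun x y : R => y <= x) by move=> y x z xy yz; apply: le_trans xy.
by apply: (sorted_leq_nth tr _ 0 (sort_sorted tot s)); rewrite ?inE ?st.
Qed.

Lemma laplacian_spectrum_exists (R : rcfType) n (G : sgraph 'I_n) :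
  exists mu, is_spectrum (laplacian R G) mu.
Proof.
apply: sym_spectrum_exists; rewrite /laplacian linearB /= tr_diag_mx.
by congr (_ - _); apply/matrixP=> i j; rewrite !mxE /adj setUC.
Qed.

End SpectrumExists.

(* Main.v *)
(* Call (i, j, k) a defect if ij is an edge, ik is not, k < j and k <> i; a
   graph without defects is shifted, hence threshold. As sum mu_i^2 is the
   trace of L^2, that is sum (d_i^2 + d_i), and the squared conjugate degrees
   sum to the sum of min (d_u, d_v) over ordered pairs, for sorted degrees the
   gap is exactly twice the number of defects.
   Order the pairs a < b componentwise. If there is a defect, then some minimal
   non-edge or some maximal edge belongs to one, and flipping it destroys a
   defect without creating any. So with at most as many flips as defects we
   reach a shifted graph; adding minimal non-edges or deleting maximal edges
   then restores the number of edges without increasing the larger of the two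
   one-sided differences with G. *)

Require Import Defs.
From mathcomp Require Import all_boot all_order all_algebra.
From mathcomp Require complex.
From mathcomp Require Import zify.

Set Implicit Arguments.
Unset Strict Implicit.
Unset Printing Implicit Defensive.

Import Order.TTheory GRing.Theory Num.Theory.

Local Open Scope ring_scope.

(** * Defects and down-closed sets in an abstract strict order *)

Section Defects.

(** To be used with [U] the pairs a < b, [lt] the componentwise order, [step] comparability with a
    shared endpoint, and [w] the sum of the entries, whose extremes pick out minimal and maximal
    elements. *)
Variables (T : finType) (U : {set T}) (lt step : rel T) (w : T -> nat).

Hypothesis lt_trans : transitive lt.
Hypothesis lt_w : forall x y, lt x y -> (w x < w y)%N.
Hypothesis step_lt : forall x y, step x y -> lt x y.
Hypothesis lt_step : forall x y, x \in U -> y \in U -> lt x y ->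
  step x y \/ exists z, [/\ z \in U, step x z & step z y].

Definition defects (E : {set T}) : {set T * T} :=
  [set d | [&& d.1 \in E, d.2 \in U :\: E & step d.2 d.1]].

Definition down_closed (H : {set T}) : Prop :=
  forall x y, x \in U -> y \in H -> lt x y -> x \in H.

Lemma in_defects (E : {set T}) x y :
  ((y, x) \in defects E) = [&& y \in E, x \in U, x \notin E & step x y].
Proof. by rewrite !inE /=; do 2!case: (_ \in E); rewrite ?andbF //= andbA. Qed.

(** Membership must change at one of the two steps from [x] through [z] to [y]: at the first if [z]
    is in [E], else at the second. *)
Lemma lt_defect (E : {set T}) x y : E \subset U ->
  x \in U -> x \notin E -> y \in E -> lt x y ->
  (exists z, (z, x) \in defects E) \/ (exists z, (y, z) \in defects E).
Proof.
move=> /subsetP sEU Ux nEx Ey /(lt_step Ux (sEU _ Ey)) [xy|[z [Uz xz zy]]].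
  by left; exists y; rewrite in_defects Ey Ux nEx.
case Ez: (z \in E); first by left; exists z; rewrite in_defects Ez Ux nEx.
by right; exists z; rewrite in_defects Ey Uz Ez.
Qed.

(* Inserting a minimal non-member or deleting a maximal member creates no
   defect, and lt_defect provides such an element that belongs to a defect. *)
Lemma defects_descent (E : {set T}) : E \subset U -> defects E != set0 ->
  exists x, x \in U /\
   ((x \notin E /\ (#|defects (x |: E)| < #|defects E|)%N) \/
    (x \in E /\ (#|defects (E :\ x)| < #|defects E|)%N)).
Proof.
move=> sEU /set0Pn [[y0 x0]].
rewrite in_defects => /and4P [Ey0 Ux0 nEx0 /step_lt xy0].
(* [x] is minimal among all non-members, since a non-member below it is also below [y0]; likewise
   [y], chosen next above [x], is maximal among all members. *)
pose P x := [&& x \in U, x \notin E & lt x y0].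
have Px0 : P x0 by rewrite /P Ux0 nEx0.
case: (arg_minnP w Px0) => x /and3P [Ux nEx xy] minx {x0 Px0 Ux0 nEx0 xy0}.
pose Q y := (y \in E) && lt x y.
have Qy0 : Q y0 by rewrite /Q Ey0.
case: (arg_maxnP w Qy0) => y /andP [Ey lxy] maxy.
case: (lt_defect sEU Ux nEx Ey lxy) => [[z dz]|[z dz]].
  exists x; split=> //; left; split=> //; apply: proper_card.
  apply/properP; split; last first.
    by exists (z, x) => //; rewrite in_defects !in_setU1 eqxx !andbF.
  apply/subsetP=> [[b a]]; rewrite !in_defects !in_setU1 negb_or.
  case/and4P=> /orP [/eqP bx|->] Ua /andP [_ nEa] ab; last by rewrite Ua nEa ab.
  move: ab; rewrite bx => /step_lt ax.
  have /minx : P a by rewrite /P Ua nEa (lt_trans ax xy).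
  by move=> /(leq_trans (lt_w ax)); rewrite ltnn.
exists y; split; first exact: (subsetP sEU).
right; split=> //; apply: proper_card; apply/properP; split; last first.
  by exists (y, z) => //; rewrite in_defects !in_setD1 eqxx.
apply/subsetP=> [[b a]]; rewrite !in_defects !in_setD1 negb_and negbK.
case/and4P=> /andP [nby Eb] Ua /orP [/eqP ay|nEa] ab; last by rewrite Eb Ua nEa.
move: ab; rewrite ay => /step_lt yb.
have /maxy : Q b by rewrite /Q Eb (lt_trans lxy yb).
by move=> /(leq_trans (lt_w yb)); rewrite ltnn.
Qed.

(** Each flip removes at least one defect and raises just one of the two differences, by at most
    one; without defects, [lt_defect] gives down-closedness. *)
Lemma down_closed_near (E : {set T}) : E \subset U ->
  exists H : {set T}, [/\ H \subset U, down_closed H,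
    (#|E :\: H| <= #|defects E|)%N & (#|H :\: E| <= #|defects E|)%N].
Proof.
have [m] := ubnP #|defects E|; elim: m E => // m IHm E; rewrite ltnS => leEm sEU.
have [d0|/defects_descent] := eqVneq (defects E) set0.
  exists E; rewrite setDv cards0; split=> // x y Ux Ey xy; apply/contraT=> nEx.
  by case: (lt_defect sEU Ux nEx Ey xy) => [[z]|[z]]; rewrite d0 inE.
case=> // x [Ux [[nEx ltE]|[Ex ltE]]].
  have [||H [sHU dH leEH leHE]] := IHm (x |: E).
  - exact: leq_trans ltE leEm.
  - by rewrite subUset sub1set Ux.
  exists H; split=> //.
    apply: leq_trans (ltnW ltE); apply: leq_trans leEH.
    by apply/subset_leq_card/setSD/subsetUr.
  apply: leq_trans ltE; apply: (@leq_trans #|x |: (H :\: (x |: E))|).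
    apply/subset_leq_card/subsetP=> z; rewrite !inE negb_or.
    by case: (z == x) => //= /andP [-> ->].
  by rewrite cardsU1 !inE eqxx /= add1n ltnS.
have [||H [sHU dH leEH leHE]] := IHm (E :\ x).
- exact: leq_trans ltE leEm.
- exact: subset_trans (subD1set _ _) sEU.
exists H; split=> //.
  apply: leq_trans ltE; apply: (@leq_trans #|x |: (E :\ x :\: H)|).
    apply/subset_leq_card/subsetP=> z; rewrite !inE.
    by case: (z == x) => //= /andP [-> ->].
  by rewrite cardsU1 !inE eqxx andbF add1n ltnS.
apply: leq_trans (ltnW ltE); apply: leq_trans leHE.
by apply/subset_leq_card/setDS/subD1set.
Qed.

Lemma down_closed_extend (H : {set T}) m : H \subset U -> down_closed H ->
  (#|H| <= m <= #|U|)%N ->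
  exists K : {set T}, [/\ K \subset U, down_closed K, H \subset K & #|K| = m].
Proof.
have [k] := ubnP (m - #|H|); elim: k H => // k IHk H ltk sHU dH /andP [leHm lemU].
have [->|neHm] := eqVneq m #|H|; first by exists H.
have ltHm : (#|H| < m)%N by rewrite ltn_neqAle eq_sym neHm.
have /subsetPn [x0 Ux0 nHx0] : ~~ (U \subset H).
  by apply: contraL ltHm => /subset_leq_card; rewrite -leqNgt; apply: leq_trans.
pose P x := (x \in U) && (x \notin H).
have Px0 : P x0 by rewrite /P Ux0.
case: (arg_minnP w Px0) => x /andP [Ux nHx] minx.
have cH : #|x |: H| = #|H|.+1 by rewrite cardsU1 nHx.
have [||||K [sKU dK sHK cK]] := IHk (x |: H).
- by rewrite cH; lia.
- by rewrite subUset sub1set Ux.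
- move=> a b Ua; rewrite !in_setU1 => /orP [/eqP ->|Hb] ab; last first.
    by rewrite (dH a b) ?orbT.
  apply/orP; right; apply/contraT=> nHa.
  have /minx : P a by rewrite /P Ua.
  by move=> /(leq_trans (lt_w ab)); rewrite ltnn.
- by rewrite cH ltHm.
by exists K; split=> //; apply: subset_trans sHK; apply: subsetUr.
Qed.

Lemma down_closed_shrink (H : {set T}) m : down_closed H -> (m <= #|H|)%N ->
  exists K : {set T}, [/\ down_closed K, K \subset H & #|K| = m].
Proof.
have [k] := ubnP (#|H| - m); elim: k H => // k IHk H ltk dH lemH.
have [->|neHm] := eqVneq m #|H|; first by exists H.
have ltHm : (m < #|H|)%N by rewrite ltn_neqAle neHm.
have /set0Pn [x0 Hx0] : H != set0 by rewrite -card_gt0 (leq_ltn_trans _ ltHm).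
case: (arg_maxnP w Hx0) => x Hx maxx.
have cH : #|H :\ x|.+1 = #|H| by rewrite (cardsD1 x H) (Hx : x \in H).
have [|||K [dK sKH cK]] := IHk (H :\ x).
- by lia.
- move=> a b Ua; rewrite !in_setD1 => /andP [nbx Hb] ab.
  rewrite (dH a b) ?andbT //; apply/eqP=> ax; rewrite ax in ab.
  by have := leq_trans (lt_w ab) (maxx _ Hb); rewrite ltnn.
- by lia.
by exists K; split=> //; apply: subset_trans sKH (subD1set _ _).
Qed.

(** Enlarging [H] cannot increase [E :\: H], and shrinking it cannot increase [H :\: E]; once the
    sizes agree, the two differences have equal size. *)
Lemma down_closed_same_card (E : {set T}) : E \subset U ->
  exists H : {set T}, [/\ H \subset U, down_closed H, #|H| = #|E|
    & (#|E :\: H| <= #|defects E|)%N].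
Proof.
move=> sEU; have [H [sHU dH leEH leHE]] := down_closed_near sEU.
have [le|lt'] := leqP #|H| #|E|.
  have [|K [sKU dK sHK cK]] := @down_closed_extend H #|E| sHU dH.
    by rewrite le subset_leq_card.
  exists K; split=> //; apply: leq_trans leEH.
  by apply/subset_leq_card/setDS.
have [K [dK sKH cK]] := down_closed_shrink dH (ltnW lt').
exists K; split=> //; first exact: subset_trans sKH sHU.
suff -> : #|E :\: K| = #|K :\: E|.
  by apply: leq_trans leHE; apply/subset_leq_card/setSD.
by rewrite !cardsD cK setIC.
Qed.

End Defects.

(** * Edges as increasing pairs; shifted and threshold graphs *)

Section Pairs.

Variable n : nat.
Implicit Types (p q : 'I_n * 'I_n) (i j k : 'I_n) (G : sgraph 'I_n).

Definition pairs : {set 'I_n * 'I_n} :=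
  [set p : 'I_n * 'I_n | (p.1 < p.2)%N].

Definition lt_pair p q : bool := [&& (p.1 <= q.1)%N, (p.2 <= q.2)%N & p != q].

(* For pairs in [pairs]: the two edges share exactly one endpoint. *)
Definition step_pair p q : bool :=
  lt_pair p q && [|| p.1 == q.1, p.2 == q.2 | p.2 == q.1].

Definition edge_of p : {set 'I_n} := [set p.1; p.2].

Definition ord_pair i j : 'I_n * 'I_n := if (i < j)%N then (i, j) else (j, i).

Definition edge_pairs G : {set 'I_n * 'I_n} :=
  [set p in pairs | edge_of p \in edges G].

Definition shift_defects G : {set 'I_n * 'I_n * 'I_n} :=
  [set t | let: (i, j, k) := t in
    [&& adj G i j, ~~ adj G i k, (k < j)%N & k != i]].

Definition shifted G : Prop :=
  forall i j k, adj G i j -> (k < j)%N -> k != i -> adj G i k.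

Lemma adjC G i j : adj G i j = adj G j i.
Proof. by rewrite /adj setUC. Qed.

Lemma adjxx G i : adj G i i = false.
Proof. by apply/negP=> /edges_card2; rewrite setUid cards1. Qed.

Lemma lt_pair_weight p q : lt_pair p q -> (p.1 + p.2 < q.1 + q.2)%N.
Proof.
case: p q => [a b] [c d]; rewrite /lt_pair xpair_eqE -!val_eqE /=; lia.
Qed.

Lemma lt_pair_trans : transitive lt_pair.
Proof.
move=> [a b] [c d] [e f]; rewrite /lt_pair !xpair_eqE -!val_eqE /=; lia.
Qed.

Lemma lt_pair_step p q : p \in pairs -> q \in pairs -> lt_pair p q ->
  step_pair p q \/ exists z, [/\ z \in pairs, step_pair p z & step_pair z q].
Proof.
case: p q => [a b] [c d]; rewrite !inE /= => ab cd lt_pq.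
have [st|nst] := boolP (step_pair (a, b) (c, d)); [by left | right].
(* Raise the larger endpoint first: a < b <= d, and both moves are proper because the two pairs
   share no endpoint. *)
exists (a, d); move: lt_pq nst ab cd.
rewrite /step_pair /lt_pair inE !xpair_eqE -!val_eqE /= => *; split; lia.
Qed.

Lemma edge_of_inj : {in pairs &, injective edge_of}.
Proof.
move=> [a b] [c d]; rewrite !inE /edge_of /= => ab cd /setP E.
have /esym := E a; have /esym := E b; have := E c; have := E d.
rewrite !inE !eqxx ?orbT /= -!val_eqE /= => *.
by congr (_, _); apply: val_inj => /=; lia.
Qed.

Lemma edge_of_ord_pair i j : edge_of (ord_pair i j) = [set i; j].
Proof. by rewrite /edge_of /ord_pair; case: ifP => //= _; rewrite setUC. Qed.

Lemma ord_pair_lt i j : (i < j)%N -> ord_pair i j = (i, j).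
Proof. by rewrite /ord_pair => ->. Qed.

Lemma ord_pair_gt i j : (j < i)%N -> ord_pair i j = (j, i).
Proof. by move=> ji; rewrite /ord_pair ltnNge ltnW. Qed.

Lemma ord_pair_pairs i j : i != j -> ord_pair i j \in pairs.
Proof. by rewrite inE /ord_pair -val_eqE /=; case: ifP => //=; lia. Qed.

Lemma edgesE G : edges G = edge_of @: edge_pairs G.
Proof.
apply/setP=> e; apply/idP/imsetP => [Ge|[p]]; last by rewrite inE => /andP [_ Gp] ->.
have /eqP/cards2P [i [j [ij eij]]] := edges_card2 Ge.
exists (ord_pair i j); rewrite ?edge_of_ord_pair //.
by rewrite inE ord_pair_pairs // edge_of_ord_pair -eij.
Qed.

Lemma card_imset_edge_of (X : {set 'I_n * 'I_n}) :
  X \subset pairs -> #|edge_of @: X| = #|X|.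
Proof.
move=> /subsetP sX; apply: card_in_imset => p q /sX Up /sX Uq.
exact: edge_of_inj.
Qed.

Lemma edge_pairs_sub G : edge_pairs G \subset pairs.
Proof. by apply/subsetP=> p; rewrite inE => /andP []. Qed.

Lemma card_defects_pairs G :
  (#|defects pairs step_pair (edge_pairs G)| <= #|shift_defects G|)%N.
Proof.
(* [f] sends a triple to its edge and its non-edge; it suffices that every defect of pairs is a
   value of [f]. *)
pose f (t : 'I_n * 'I_n * 'I_n) :=
  (ord_pair t.1.1 t.1.2, ord_pair t.1.1 t.2).
apply: leq_trans (leq_imset_card f _).
apply/subset_leq_card/subsetP => [[[c d] [a b]]].
rewrite in_defects !inE /= => /and4P [/andP [cd Gcd] ab].
rewrite ab /= => nGab; have {Gcd} Gcd : adj G c d by [].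
have {nGab} nGab : ~~ adj G a b by [].
rewrite /step_pair /lt_pair xpair_eqE /= => /andP [/and3P [ac bd ne]].
(* The shared endpoint is the smaller one of both pairs, the larger one of both, or the larger of
   the non-edge and the smaller of the edge. *)
case/or3P=> /eqP e.
- apply/imsetP; exists (a, d, b); last by rewrite /f /= !ord_pair_lt ?e // -e.
  rewrite inE nGab {1}e Gcd; move: ne ab; rewrite e -!val_eqE /=; lia.
- apply/imsetP; exists (b, c, a).
    rewrite inE !(adjC G b) nGab e Gcd; move: ne ab; rewrite e -!val_eqE /=; lia.
  by rewrite /f /= !ord_pair_gt ?e // -e.
- apply/imsetP; exists (b, d, a).
    rewrite inE (adjC G b a) nGab {1}e Gcd; move: ne ab; rewrite -!val_eqE /=; lia.
  by rewrite /f /= ord_pair_lt ?ord_pair_gt // e.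
Qed.

Lemma pairs_graph (X : {set 'I_n * 'I_n}) : X \subset pairs ->
  exists H : sgraph 'I_n, edge_pairs H = X.
Proof.
move=> sX; have c2 e : e \in edge_of @: X -> #|e| = 2%N.
  case/imsetP=> p /(subsetP sX); rewrite inE => lt_p ->.
  by rewrite cards2 -val_eqE /= neq_ltn lt_p.
exists (SGraph c2); apply/setP=> p; rewrite inE /=; apply/andP/idP.
  by case=> Up /imsetP [q Xq] /edge_of_inj -> //; apply: (subsetP sX).
by move=> Xp; rewrite imset_f ?(subsetP sX).
Qed.

(** Lowering one endpoint of an unordered pair lowers the sorted pair componentwise, even if the
    endpoints change order. *)
Lemma down_closed_shifted G :
  down_closed pairs lt_pair (edge_pairs G) -> shifted G.
Proof.
move=> dG i j k Gij kj ki.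
have ij : i != j by apply: contraTneq Gij => ->; rewrite adjxx.
suff : ord_pair i k \in edge_pairs G by rewrite inE edge_of_ord_pair => /andP [].
apply: (dG _ (ord_pair i j)).
- by rewrite ord_pair_pairs // eq_sym.
- by rewrite inE ord_pair_pairs // edge_of_ord_pair.
move: ij ki kj; rewrite /ord_pair -!val_eqE /=.
by case: ifP; case: ifP; rewrite /lt_pair xpair_eqE -!val_eqE /=; lia.
Qed.

(* The vertex of least label dominates if it is adjacent to the vertex of
   greatest label; otherwise the latter is isolated. *)
Lemma shifted_build G (V : {set 'I_n}) : shifted G -> V != set0 ->
  threshold_build V [set e in edges G | e \subset V].
Proof.
move=> shG; have [m] := ubnP #|V|; elim: m V => // m IHm V; rewrite ltnS => leVm.
case/set0Pn=> v0 Vv0.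
case: (arg_minnP (fun i : 'I_n => i : nat) Vv0) => a Va mina.
case: (arg_maxnP (fun i : 'I_n => i : nat) Vv0) => b Vb maxb.
have {}Va : a \in V by []; have {}Vb : b \in V by [].
have [eab|neab] := eqVneq a b.
  have VE : V = [set a].
    apply/setP=> x; rewrite inE; apply/idP/eqP => [Vx|->] //.
    by apply: val_inj; have := mina _ Vx; have := maxb _ Vx; rewrite -eab /=; lia.
  have -> : [set e in edges G | e \subset V] = set0.
    apply/setP=> e; rewrite !inE; apply/negP=> /andP [/edges_card2 c2].
    by move/subset_leq_card; rewrite VE cards1 c2.
  by rewrite VE; constructor.
have del v : v \in V -> (#|V :\ v| < m)%N.
  by move=> Vv; move: leVm; rewrite (cardsD1 v V) Vv.
case Gab: (adj G a b).
  have -> : [set e in edges G | e \subset V] =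
      [set e in edges G | e \subset V :\ a] :|: [set [set a; w] | w in V :\ a].
    apply/setP=> e; rewrite !inE subsetD1; apply/andP/orP.
      case=> Ge sV; have [ea|nea] := boolP (a \in e); last by left; rewrite Ge sV.
      right; have /eqP/cards2P [i [j [ij eij]]] := edges_card2 Ge.
      move: ea sV; rewrite eij !inE subUset !sub1set => /orP [] /eqP ae /andP [Vi Vj].
        by apply/imsetP; exists j; rewrite -?ae // !inE ae Vj eq_sym ij.
      by apply/imsetP; exists i; rewrite ?ae 1?setUC // !inE Vi ij.
    case=> [/and3P [-> -> _] //|/imsetP [x]]; rewrite !inE => /andP [xa Vx] ->.
    split; last by rewrite subUset !sub1set Va Vx.
    have [->//|xb] := eqVneq x b; apply: (shG a b x) => //.
    by have := maxb _ Vx; move: xb; rewrite -val_eqE /=; lia.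
  rewrite -{1}(setD1K Va); apply: ThresholdDominating; first by rewrite !inE eqxx.
  by apply: IHm; [exact: del | apply/set0Pn; exists b; rewrite !inE eq_sym neab].
have -> : [set e in edges G | e \subset V] = [set e in edges G | e \subset V :\ b].
  (* An edge from [b] into [V] could be shifted to the absent edge between [b] and [a]. *)
  have nb x : x \in V -> adj G b x = false.
    move=> Vx; apply/negP=> Gbx; case/negP: Gab; rewrite adjC.
    have [<-//|ax] := eqVneq x a; apply: (shG b x a) => //.
    by have := mina _ Vx; move: ax; rewrite -val_eqE /=; lia.
  apply/setP=> e; rewrite !inE subsetD1; case Ge: (e \in edges G) => //=.
  case sV: (e \subset V) => //=; apply/esym/negP => be.
  have /eqP/cards2P [i [j [ij eij]]] := edges_card2 Ge.
  move: be sV Ge; rewrite eij !inE subUset !sub1set => /orP [] /eqP <- /andP [Vi Vj] Ge.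
    by have := nb _ Vj; rewrite /adj Ge.
  by have := nb _ Vi; rewrite /adj setUC Ge.
rewrite -{1}(setD1K Vb); apply: ThresholdIsolated; first by rewrite !inE eqxx.
by apply: IHm; [exact: del | apply/set0Pn; exists a; rewrite !inE neab].
Qed.

Lemma shifted_threshold G : (0 < n)%N -> shifted G -> is_threshold G.
Proof.
move=> n_gt0 shG; rewrite /is_threshold.
have -> : edges G = [set e in edges G | e \subset [set: 'I_n]].
  by apply/setP=> e; rewrite inE subsetT andbT.
by apply: shifted_build => //; apply/set0Pn; exists (Ordinal n_gt0).
Qed.

Lemma threshold_near G : (0 < n)%N -> exists H : sgraph 'I_n,
  [/\ is_threshold H, #|edges H| = #|edges G|
    & (#|symdiff (edges G) (edges H)| <= 2 * #|shift_defects G|)%N].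
Proof.
move=> n_gt0.
have step_lt p q : step_pair p q -> lt_pair p q by case/andP.
have [X [sX dX cX leX]] := down_closed_same_card lt_pair_trans lt_pair_weight
  step_lt lt_pair_step (edge_pairs_sub G).
have [H HX] := pairs_graph sX.
exists H; split.
- by apply: shifted_threshold => //; apply: down_closed_shifted; rewrite HX.
- by rewrite !edgesE !card_imset_edge_of ?edge_pairs_sub // HX.
have imD (A B : {set 'I_n * 'I_n}) :
    (#|edge_of @: A :\: edge_of @: B| <= #|A :\: B|)%N.
  apply: leq_trans (leq_imset_card edge_of _); apply/subset_leq_card/subsetP=> e.
  case/setDP=> /imsetP [p Ap ->] nB; apply: imset_f; rewrite inE Ap andbT.
  by apply: contra nB; apply: imset_f.
apply: leq_trans (leq_card_setU _ _) _; rewrite mul2n -addnn !edgesE HX.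
have leE := leq_trans leX (card_defects_pairs G).
apply: leq_add; apply: leq_trans (imD _ _) _ => //.
(* Equal edge counts make the two one-sided differences equally large, so one bound serves both
   halves. *)
suff -> : #|X :\: edge_pairs G| = #|edge_pairs G :\: X| by [].
by rewrite !cardsD cX setIC.
Qed.

End Pairs.

(** * Double counting of degrees and defects *)

Section Counting.

Local Open Scope nat_scope.

Lemma sum_ltn (n m : nat) : \sum_(k < n) (k < m : nat) = minn m n.
Proof.
elim: n => [|n IHn]; first by rewrite big_ord0 minn0.
by rewrite big_ord_recr /= IHn; case: ltnP; lia.
Qed.

Lemma sum_sym (n : nat) (F : 'I_n -> 'I_n -> nat) :
  (forall i j, F i j = F j i) ->
  \sum_i \sum_j F i j =
  \sum_i F i i + 2 * \sum_(i < n) \sum_(j < n) (j < i) * F i j.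
Proof.
move=> symF; rewrite mul2n -addnn [X in _ + (_ + X)]exchange_big -!big_split /=.
apply: eq_bigr => i _; rewrite -big_split (bigD1 i) //= [in RHS](bigD1 i) //=.
rewrite ltnn; congr (_ + _); apply: eq_bigr => j; rewrite -val_eqE /= symF.
by case: ltngtP => // _ _; rewrite ?mul1n ?mul0n ?addn0.
Qed.

Variable n : nat.
Implicit Type G : sgraph 'I_n.

Lemma degE G i : deg G i = \sum_j adj G i j.
Proof. by rewrite /deg cardsE -sum1_card big_mkcond. Qed.

Lemma deg_le G i : deg G i <= n.
Proof. by rewrite -[n in _ <= n]card_ord max_card. Qed.

(** The square counts ordered pairs of vertices both of degree at least r; a fixed pair is counted
    once for each r from 1 to the smaller degree, which is at most n. *)
Lemma sum_conj_deg_sqr G :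
  \sum_(1 <= r < n.+1) conj_deg G r ^ 2 =
  \sum_u \sum_v minn (deg G u) (deg G v).
Proof.
have cdE r : conj_deg G r = \sum_u (r <= deg G u).
  by rewrite /conj_deg cardsE -sum1_card big_mkcond.
rewrite big_add1 /= big_mkord.
under [LHS]eq_bigr => r _ do rewrite cdE -mulnn big_distrl.
rewrite exchange_big; apply: eq_bigr => u _ /=.
under [LHS]eq_bigr => r _ do rewrite big_distrr.
rewrite exchange_big; apply: eq_bigr => v _ /=.
rewrite -[RHS](minn_idPl (leq_trans (geq_minl _ _) (deg_le G u))) -sum_ltn.
by apply: eq_bigr => r _; rewrite leq_min mulnb.
Qed.

(** Labels start at 0, so vertex [i] has exactly [i] predecessors, all of at least its degree. *)
Lemma sum_minn_deg G :
  (forall i j : 'I_n, i <= j -> deg G j <= deg G i) ->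
  \sum_u \sum_v minn (deg G u) (deg G v) =
  \sum_u deg G u + 2 * \sum_(u < n) u * deg G u.
Proof.
move=> sG; rewrite sum_sym => [|i j]; last exact: minnC.
congr (_ + 2 * _); apply: eq_bigr => i _; first by rewrite minnn.
rewrite -[X in _ = X * _](minn_idPl (ltnW (ltn_ord i))) -sum_ltn big_distrl.
apply: eq_bigr => j _ /=; case: ltnP => // ji.
by rewrite (minn_idPl (sG _ _ (ltnW ji))).
Qed.

(* In row i, the neighbours j have j - [i < j] smaller labels other than i;
   those that are neighbours too contribute deg i (deg i - 1) / 2 in total. *)
Lemma card_shift_defects G :
  2 * #|shift_defects G| + \sum_i deg G i ^ 2 = 2 * \sum_(i < n) i * deg G i.
Proof.
pose a i j : nat := adj G i j.
have TE : #|shift_defects G| =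
    \sum_(i < n) \sum_(j < n) \sum_(k < n) a i j * (~~ adj G i k) * (k < j) * (k != i).
  rewrite -sum1_card big_mkcond /= !pair_bigA /=.
  apply: eq_bigr => [[[i j] k] _] /=; rewrite inE /a.
  by case: (adj G i j); case: (adj G i k); case: (k < j); case: (k != i).
(* Adding the triples in which [k] is a neighbour of [i] too removes the non-adjacency condition. *)
have SE : #|shift_defects G| +
    \sum_i \sum_(j < n) \sum_(k < n) (k < j) * (a i j * a i k) =
    \sum_i \sum_j a i j * \sum_(k < n) (k < j) * (k != i).
  rewrite TE -big_split; apply: eq_bigr => i _ /=; rewrite -big_split.
  apply: eq_bigr => j _ /=; rewrite -big_split big_distrr.
  apply: eq_bigr => k _ /=; rewrite /a.
  have [->|] := eqVneq k i; first by rewrite adjxx !muln0.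
  by case: (adj G i j); case: (adj G i k); case: (k < j).
have lt_ne (i j : 'I_n) : \sum_(k < n) (k < j) * (k != i) + (i < j) = j.
  rewrite -[RHS](minn_idPl (ltnW (ltn_ord j))) -sum_ltn.
  rewrite (bigD1 i) //= eqxx muln0 add0n [RHS](bigD1 i) //= addnC.
  by congr (_ + _); apply: eq_bigr => k ->; rewrite muln1.
have symP : \sum_i deg G i ^ 2 =
    \sum_i deg G i + 2 * \sum_i \sum_(j < n) \sum_(k < n) (k < j) * (a i j * a i k).
  rewrite big_distrr -big_split; apply: eq_bigr => i _ /=.
  rewrite -mulnn degE big_distrl /=.
  under eq_bigr => j _ do rewrite big_distrr /=.
  rewrite sum_sym => [|j k]; last exact: mulnC.
  by congr (_ + _); apply: eq_bigr => j _; rewrite mulnb andbb.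
have symA : \sum_i deg G i = 2 * \sum_i \sum_(j < n) a i j * (i < j).
  under eq_bigr => i _ do rewrite degE.
  rewrite sum_sym => [|i j]; last by rewrite adjC.
  rewrite big1 => [|i _]; last by rewrite adjxx.
  rewrite add0n exchange_big; congr (2 * _); apply: eq_bigr => i _.
  by apply: eq_bigr => j _; rewrite mulnC adjC.
have SA : \sum_i \sum_j a i j * (\sum_(k < n) (k < j) * (k != i)) +
    \sum_i \sum_(j < n) a i j * (i < j) = \sum_(i < n) i * deg G i.
  rewrite -big_split; under eq_bigr => i _ do rewrite -big_split /=.
  rewrite exchange_big; apply: eq_bigr => j _ /=.
  rewrite degE big_distrr /=; apply: eq_bigr => i _ /=.
  by rewrite -mulnDr lt_ne mulnC adjC.
(* With D defects, P the triple sum of [symP], S the right side of [SE] and A the sum in [symA]: D +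
   P = S, the squared degrees sum to 2A + 2P, and S + A is the sum of [i * deg G i]. *)
lia.
Qed.

End Counting.

(** * The spectral second moment and the gap *)

Section SpectralMoment.

Import complex.

(** Over the complex extension [A] is unitarily diagonalizable; its characteristic polynomial
    determines the diagonal up to order, and the trace is invariant under conjugation. *)
Lemma spectrum_sqr (R : rcfType) (n : nat) (A : 'M[R]_n) (mu : 'I_n -> R) :
  A^T = A -> is_spectrum A mu -> \sum_i mu i ^+ 2 = \tr (A *m A).
Proof.
move=> symA [cpA _]; pose f := real_complex R; pose B := map_mx f A.
have hermB : B \is hermsymmx.
  apply: realsym_hermsym.
    by apply/is_hermitianmxP; rewrite expr0 scale1r map_mx_id // map_trmx symA.
  by apply/mxOverP=> i j; rewrite mxE complex_real.
have /hermitian_normalmx/orthomx_spectralP BE := hermB.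
set P := spectralmx B in BE; set d := spectral_diag B in BE.
have uP : P \in unitmx by apply: spectral_unit.
have perm_mu : perm_eq [seq f (mu i) | i <- enum 'I_n] [seq d 0 i | i <- enum 'I_n].
  apply: prod_XsubC_eq; rewrite big_map [in RHS]big_map !big_enum /=.
  have := congr1 (map_poly f) cpA; rewrite map_char_poly -/B BE.
  rewrite char_poly_conj // char_poly_trig ?diag_mx_is_trig // rmorph_prod => cp.
  under eq_bigr => i _ do rewrite -map_polyC -(map_polyX f) -rmorphB.
  rewrite -cp; apply: eq_bigr => i _; by rewrite mxE eqxx mulr1n.
apply: (fmorph_inj f); rewrite rmorph_sum -trace_map_mx map_mxM -/B.
have -> : \tr (B *m B) = \sum_i d 0 i ^+ 2.
  rewrite BE !mulmxA mulmxK // mxtrace_mulC !mulmxA mulmxV // mul1mx.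
  rewrite mulmx_diag mxtrace_diag.
  by apply: eq_bigr => i _; rewrite mxE expr2.
have := perm_big _ perm_mu (op := +%R) (x := 0) (F := fun x => x ^+ 2) (P := xpredT).
rewrite big_map [in RHS]big_map !big_enum /= => <-.
by apply: eq_bigr => i _; rewrite rmorphXn.
Qed.

End SpectralMoment.

(** In row [i], the diagonal entry contributes the squared degree and each neighbour contributes
    (-1)^2. *)
Lemma tr_laplacian_sqr (R : rcfType) (n : nat) (G : sgraph 'I_n) :
  \tr (laplacian R G *m laplacian R G) =
  (\sum_i deg G i ^ 2 + \sum_i deg G i)%:R.
Proof.
rewrite -big_split natr_sum /mxtrace; apply: eq_bigr => i _.
rewrite mxE (bigD1 i) //= !mxE eqxx mulr1n adjxx subr0 natrD natrX -expr2.
congr (_ + _); rewrite degE natr_sum [RHS](bigD1 i) //= adjxx add0r.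
apply: eq_bigr => j ij; rewrite !mxE eq_sym (negPf ij) !mulr0n !sub0r.
by rewrite (adjC G j) mulrNN -natrM mulnb andbb.
Qed.

Lemma laplacian_sym (R : rcfType) (n : nat) (G : sgraph 'I_n) :
  (laplacian R G)^T = laplacian R G.
Proof.
rewrite /laplacian linearB /= tr_diag_mx; congr (_ - _).
by apply/matrixP=> i j; rewrite !mxE adjC.
Qed.

(** The plain degree sum occurs in both moments and cancels; [card_shift_defects] evaluates the
    rest. *)
Lemma second_moment_gapE (R : rcfType) (n : nat) (G : sgraph 'I_n)
    (mu : 'I_n -> R) :
  (forall i j : 'I_n, (i <= j)%N -> (deg G j <= deg G i)%N) ->
  is_spectrum (laplacian R G) mu ->
  second_moment_gap G mu = (2 * #|shift_defects G|)%:R.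
Proof.
move=> sG /(spectrum_sqr (laplacian_sym R G)) sq.
rewrite /second_moment_gap sq tr_laplacian_sqr.
under [X in X - _]eq_bigr => r _ do rewrite -natrX.
rewrite -natr_sum sum_conj_deg_sqr sum_minn_deg // -card_shift_defects.
by rewrite [X in _ - X%:R]addnC addnCA natrD addrK.
Qed.

Theorem corollary6p3 (R : rcfType) (n : nat) (n_gt0 : (0 < n)%N)
    (G : sgraph 'I_n) (mu : 'I_n -> R)
    (deg_sorted : forall i j : 'I_n, (i <= j)%N -> (deg G j <= deg G i)%N)
    (mu_spectrum : is_spectrum (laplacian R G) mu) :
  (exists H : sgraph 'I_n,
     [/\ is_threshold H,
         #|edges H| = #|edges G|
       & #|symdiff (edges G) (edges H)|%:R / 2%:R
           <= second_moment_gap G mu / 2%:R :> R]) /\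
  (second_moment_gap G mu = 0 -> is_threshold G).
Proof.
rewrite (second_moment_gapE deg_sorted mu_spectrum).
have [H [thH cH leH]] := threshold_near G n_gt0.
split; first by exists H; split=> //; rewrite ler_pM2r ?invr_gt0 ?ltr0n // ler_nat.
(* A zero gap means no defects, so the symmetric difference is empty and [G] has the edges of
   [H]. *)
move/eqP; rewrite pnatr_eq0 => /eqP gap0; move: leH.
rewrite gap0 leqn0 cards_eq0 /symdiff setU_eq0 !setD_eq0 -eqEsubset => /eqP eGH.
by rewrite /is_threshold eGH.
Qed.
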